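(* Let $n$ be even. For any complete oriented flags $F_0,\dots,F_{n+1}$ in $\mathbb{R}^n$, $dE(F_0,\dots,F_{n+1})=0$.
   Context: A complete oriented flag $F$ is a chain $\{0\}=F^0\subset\dots\subset F^n=\mathbb{R}^n$, $\dim F^i=i$, each $F^i$ with a chosen open half-space $(F^i)^+$ bounded by $F^{i-1}$ (equivalently orientations on each $F^i$ compatible as follows: $(v_1,\dots,v_{i-1},x)$ is positive in $F^i$ iff $(v_1,\dots,v_{i-1})$ is positive in $F^{i-1}$ and $x\in(F^i)^+$). For an oriented $k$-dimensional subspace $W$ ($0\le k\le n-1$) and complete oriented flag $F$, let $d$ be the unique $1\le d\le k+1$ with $F^{d-1}\subseteq W$, $F^d\not\subseteq W$; $[W,F]$ is $W+F^d$ oriented by a positive basis of $W$ followed by any $x\in(F^d)^+$. Set $[F_1]=F_1^1$ and $[F_1,\dots,F_k]=[[F_1,\dots,F_{k-1}],F_k]$. For an oriented $n$-dimensional space $U$, $\mathrm{Or}(U)\in\{\pm1\}$ is the sign of its orientation relative to the canonical orientation of $\mathbb{R}^n$. Define $E$ on $(n+1)$-tuples of complete oriented flags by $E(F_0,\dots,F_n)=\prod_{i=0}^n\mathrm{Or}([F_0,\dots,\widehat{F_i},\dots,F_n])\in\{\pm1\}$, and $dE(F_0,\dots,F_{n+1})=\sum_{i=0}^{n+1}(-1)^iE(F_0,\dots,\widehat{F_i},\dots,F_{n+1})$. *)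

(* Defs.v *)
From HB Require Import structures.
From mathcomp Require Import all_boot all_order all_algebra.
Set Implicit Arguments. Unset Strict Implicit. Unset Printing Implicit Defensive.
Import Order.TTheory GRing.Theory Num.Theory.
Local Open Scope ring_scope.

(* A complete oriented flag F in R^n is represented by an invertible matrix
   F : 'M[R]_n whose rows v_1,...,v_n (row i = v_(i+1)) satisfy
   F^i = span(v_1,...,v_i) and v_i \in (F^i)^+.  Every complete oriented flag
   arises this way, and every invertible matrix gives one. *)
Definition is_flag (R : fieldType) (n : nat) (F : 'M[R]_n) : bool := F \in unitmx.

(* An oriented subspace W is represented by a positive basis, as a list of
   row vectors; its span is the row space of the stacked matrix. *)
Definition stack (R : fieldType) (n : nat) (s : seq 'rV[R]_n) : 'M[R]_(size s, n) :=
  \matrix_(i < size s) nth 0 s i.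

(* [W, F]: let d be such that F^(d-1) <= W and F^d not <= W, i.e. row d-1 of F
   is the first row not in W.  Then W + F^d is oriented by the basis of W
   followed by v_d, which lies in (F^d)^+. *)
Definition ext (R : fieldType) (n : nat) (s : seq 'rV[R]_n) (F : 'M[R]_n)
  : seq 'rV[R]_n :=
  match [pick i : 'I_n | ~~ (row i F <= stack s)%MS
                        && [forall j : 'I_n, (j < i)%N ==> (row j F <= stack s)%MS]] with
  | Some i => rcons s (row i F)
  | None => s
  end.

Definition bracket (R : fieldType) (n : nat) (Fs : seq 'M[R]_n) : seq 'rV[R]_n :=
  foldl (@ext R n) [::] Fs.

Definition Or (R : realFieldType) (n : nat) (s : seq 'rV[R]_n) : int :=
  if 0 < \det (\matrix_(i < n) nth 0 s i) then 1%R else (-1)%R.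

Definition omit (T : Type) (i : nat) (s : seq T) : seq T := take i s ++ drop i.+1 s.

Definition E (R : realFieldType) (n : nat) (Fs : seq 'M[R]_n) : int :=
  \prod_(i < size Fs) Or (bracket (omit i Fs)).

Definition dE (R : realFieldType) (n : nat) (Fs : seq 'M[R]_n) : int :=
  \sum_(i < size Fs) (-1) ^+ i * E (omit i Fs).

(* Main.v *)
Require Import Defs.
From HB Require Import structures.
From mathcomp Require Import all_boot all_order all_algebra.
From mathcomp Require Import ring.
Import Order.TTheory GRing.Theory Num.Theory.
Local Open Scope ring_scope.

(* Replace each flag F_k, with rows f_1, ..., f_n, by the vector
   v_k = f_1 + t_k f_2 + ... + t_k^(n-1) f_n, where 0 < t_0 << t_1 << ... << 1:
   the orientation of [F_(i_1), ..., F_(i_n)] becomes the sign of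
   det (v_(i_1), ..., v_(i_n)).  For n + 2 vectors in R^n all of whose maximal
   minors are nonzero, Gale duality identifies the minor omitting v_i and v_j, up
   to (-1)^(i+j) and a constant, with an antisymmetric form G i j of rank 2.  As n
   is even the signs (-1)^(i+j) absorb the (-1)^i of the coboundary, leaving
   sum_i prod_(j != i) sgn (G i j).  Reversing vectors only changes a global sign,
   so the indices may be taken to be linearly ordered by G; the terms are then
   the signs of their ranks, and an even number of alternating signs cancel. *)

(** * Sign sums for antisymmetric forms of rank 2 *)

(** Each [j] with [r j < r i] contributes a factor -1, so the product at [i] is -1 to the rank of
    [i]. The ranks permute 0, ..., m - 1, which leaves an alternating sum of [m] signs. *)
Lemma sum_prod_sgz_sub (R : realFieldType) (m : nat) (r : 'I_m -> R) :
  injective r ->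
  \sum_(i < m) \prod_(k < m.-1) sgz (r (lift i k) - r i) = (odd m)%:R.
Proof.
move=> r_inj; pose below i := [set j | r j < r i].
have ltm i : (#|below i| < m)%N.
  rewrite -[X in (_ < X)%N]card_ord -cardsT; apply: proper_card.
  by apply/properP; split; [exact: subsetT | exists i; rewrite ?inE ?ltxx].
pose rk i := Ordinal (ltm i).
have below_proper i j : r i < r j -> (#|below i| < #|below j|)%N.
  move=> rij; apply: proper_card; apply/properP; split.
    by apply/subsetP => k; rewrite !inE => /lt_trans; apply.
  by exists i; rewrite !inE ?ltxx.
have rk_inj : injective rk.
  move=> i j /(congr1 val) /= eq_ij; apply: r_inj.
  by case: (ltgtP (r i) (r j)) => // /below_proper; rewrite eq_ij ltnn.
have termE i : \prod_(k < m.-1) sgz (r (lift i k) - r i) = (-1) ^+ rk i.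
  pose f j : int := if r j < r i then -1 else 1.
  transitivity (\prod_(j < m) f j).
    rewrite (bigD1_ord i) //= {1}/f ltxx mul1r; apply: eq_bigr => k _.
    rewrite /f; case: (ltgtP (r (lift i k)) (r i)) => [lt|gt|/r_inj /eqP].
    - by rewrite ltr0_sgz ?subr_lt0.
    - by rewrite gtr0_sgz ?subr_gt0.
    - by rewrite eq_sym (negPf (neq_lift _ _)).
  by rewrite /f -big_mkcond /= prodr_const /rk /= cardsE.
rewrite (eq_bigr _ (fun i _ => termE i)).
transitivity (\sum_(k < m) (-1) ^+ k : int).
  by rewrite [RHS](reindex_inj rk_inj).
elim: m {r r_inj below ltm rk below_proper rk_inj termE} => [|m IHm].
  by rewrite big_ord0.
by rewrite big_ord_recr /= IHm -signr_odd; case: (odd m).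
Qed.

(* The Grassmann-Pluecker relation makes [r k = G 1 k / (G 0 1 * G 0 k)] satisfy
   [G k l = G 0 k * G 0 l * (r l - r k)]: up to reorientation, [G] orders its
   indices linearly, with [0] as least element. *)
Lemma sum_prod_sgz_rank2 (R : realFieldType) (n : nat)
    (G : 'I_n.+2 -> 'I_n.+2 -> R) (i1 := lift ord0 ord0) :
  ~~ odd n ->
  (forall i j, G j i = - G i j) ->
  (forall i j, i != j -> G i j != 0) ->
  (forall k l, G ord0 i1 * G k l = G ord0 k * G i1 l - G ord0 l * G i1 k) ->
  \sum_(i < n.+2) \prod_(k < n.+1) sgz (G i (lift i k)) = 0.
Proof.
move=> n_even anti G_neq0 GP.
pose a (k : 'I_n.+1) := G ord0 (lift ord0 k).
have a_neq0 k : a k != 0 by exact/G_neq0/neq_lift.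
pose r k := G i1 (lift ord0 k) / (a ord0 * a k).
have GE k l : G (lift ord0 k) (lift ord0 l) = a k * a l * (r l - r k).
  apply: (mulfI (a_neq0 ord0)); rewrite GP /r -/(a k) -/(a l).
  by field; rewrite !a_neq0.
have r_inj : injective r.
  move=> k l rkl; apply/eqP/negPn/negP => neq_kl.
  have /negP[] : G (lift ord0 k) (lift ord0 l) != 0.
    by apply: G_neq0; rewrite (inj_eq lift_inj).
  by rewrite GE rkl subrr mulr0.
pose S := \prod_(k < n.+1) sgz (a k).
rewrite big_ord_recl -/S.
(* The entry at 0 is [- a i]; the other [n] entries share the factor [a i], and the [n]-th power of
   its sign is 1 as [n] is even. The odd number of remaining rows thus sum to [- S], against [S]
   from row 0. *)
have termE (i : 'I_n.+1) :
    \prod_(k < n.+1) sgz (G (lift ord0 i) (lift (lift ord0 i) k)) =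
    - S * \prod_(k < n) sgz (r (lift i k) - r i).
  rewrite big_ord_recl.
  have -> : lift (lift ord0 i) ord0 = ord0 by apply: val_inj.
  have liftS (k : 'I_n) : lift (lift ord0 i) (lift ord0 k) = lift ord0 (lift i k).
    by apply: val_inj; rewrite /= /bump /= !add1n ltnS addnS.
  under eq_bigr => k _ do rewrite liftS GE !sgzM.
  rewrite !big_split /= prodr_const card_ord anti sgzN -/(a i).
  rewrite /S (bigD1_ord i) //=.
  have -> : sgz (a i) ^+ n = 1.
    by rewrite (sgz_odd n (a_neq0 i)) (negPf n_even).
  by rewrite mul1r !mulrA mulNr.
rewrite (eq_bigr _ (fun i _ => termE i)) -big_distrr /=.
by rewrite (@sum_prod_sgz_sub R n.+1 r r_inj) /= n_even mulr1 addrN.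
Qed.

(** * Gale dual of n + 2 vectors in dimension n *)

Lemma row'_col'E (R : Type) (m n : nat) (A : 'M[R]_(m.+1, n.+1)) i j r c :
  row' i (col' j A) r c = A (lift i r) (lift j c).
Proof. by rewrite !mxE. Qed.

(* The columns [e_i], [e_j] prepended to [V] make [G i j] a Gale dual of the
   rows of [V]: up to sign it is the minor of [V] omitting rows [i] and [j]. *)
Definition gale_mx {R : comPzRingType} {n : nat} (V : 'M[R]_(n.+2, n)) (x y : 'cV[R]_n.+2) :
  'M[R]_n.+2 := row_mx x (row_mx y V : 'M_(_, 1 + n)).

Definition gale {R : comPzRingType} {n : nat} (V : 'M[R]_(n.+2, n)) (i j : 'I_n.+2) : R :=
  \det (gale_mx V (delta_mx i 0) (delta_mx j 0)).

Section Gale.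
Variables (R : fieldType) (n : nat) (V : 'M[R]_(n.+2, n)).

Lemma gale_mx0 (x y : 'cV[R]_n.+2) r : gale_mx V x y r ord0 = x r 0.
Proof. by rewrite mxE; case: splitP => // k _; rewrite ord1. Qed.

Lemma gale_mx1 (x y : 'cV[R]_n.+2) r : gale_mx V x y r (lift ord0 ord0) = y r 0.
Proof.
have -> : lift ord0 ord0 = rshift 1 (lshift n 0) :> 'I_(1 + (1 + n)) by apply: val_inj.
exact: etrans (row_mxEr _ _ _ _) (row_mxEl _ _ _ _).
Qed.

Lemma gale_mxSS (x y : 'cV[R]_n.+2) r c :
  gale_mx V x y r (lift ord0 (lift ord0 c)) = V r c.
Proof.
have -> : lift ord0 (lift ord0 c) = rshift 1 (rshift 1 c) :> 'I_(1 + (1 + n)).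
  exact: val_inj.
exact: etrans (row_mxEr _ _ _ _) (row_mxEr _ _ _ _).
Qed.

(** The cofactors of the second column do not involve [y], so they may be taken at [y = 0]; this
    exhibits linearity in [y]. *)
Lemma det_gale_mx1 (x y : 'cV[R]_n.+2) :
  \det (gale_mx V x y) =
  \sum_j y j 0 * cofactor (gale_mx V x 0) j (lift ord0 ord0).
Proof.
rewrite (expand_det_col _ (lift ord0 ord0)); apply: eq_bigr => j _.
rewrite gale_mx1; congr (_ * (_ * \det _)); apply/matrixP => r c.
rewrite !row'_col'E.
case: (unliftP ord0 (lift (lift ord0 ord0) c)) => [c1 e | ->]; last first.
  by rewrite !gale_mx0.
rewrite e; case: (unliftP ord0 c1) e => [c2 -> _| -> /eqP].
  by rewrite !gale_mxSS.
by rewrite eq_sym (negPf (neq_lift _ _)).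
Qed.

(** Expand along the two unit columns: once row [i] is removed, row [lift i k] has index [k], hence
    the exponent [i + k]. *)
Lemma gale_lift (i : 'I_n.+2) (k : 'I_n.+1) :
  gale V i (lift i k) = (-1) ^+ (i + k) * \det (row' k (row' i V)).
Proof.
rewrite /gale (expand_det_col _ ord0) (bigD1 i) //= big1 ?addr0; last first.
  by move=> j ji; rewrite gale_mx0 mxE (negPf ji) mul0r.
rewrite gale_mx0 mxE !eqxx mul1r /cofactor addn0 exprD -mulrA.
congr (_ * _); rewrite (expand_det_col _ ord0) (bigD1 k) //= big1 ?addr0; last first.
  move=> j ji; rewrite [X in X * _]row'_col'E gale_mx1 mxE (inj_eq lift_inj).
  by rewrite (negPf ji) mul0r.
rewrite [X in X * _]row'_col'E gale_mx1 mxE !eqxx mul1r /cofactor addn0.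
congr (_ * \det _); apply/matrixP => r c.
by rewrite 2!row'_col'E gale_mxSS !mxE.
Qed.

Lemma gale_anti (i j : 'I_n.+2) : gale V j i = - gale V i j.
Proof.
rewrite /gale.
have -> : gale_mx V (delta_mx j 0) (delta_mx i 0) =
    xcol ord0 (lift ord0 ord0) (gale_mx V (delta_mx i 0) (delta_mx j 0)).
  apply/matrixP => r c; rewrite [RHS]mxE.
  case: (unliftP ord0 c) => [c1 -> | ->]; last by rewrite perm.tpermL gale_mx0 gale_mx1.
  case: (unliftP ord0 c1) => [c2 -> | ->]; last by rewrite perm.tpermR gale_mx0 gale_mx1.
  by rewrite perm.tpermD // !gale_mxSS.
by rewrite xcolE det_mulmx det_perm perm.odd_tperm /= mulrN1.
Qed.

(** By linearity in the second column, the sum is a determinant in which column [c] of [V] occurs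
    twice. *)
Lemma gale_mulmx (i : 'I_n.+2) (c : 'I_n) : \sum_j gale V i j * V j c = 0.
Proof.
pose x : 'cV[R]_n.+2 := delta_mx i 0.
transitivity (\det (gale_mx V x (col c V))).
  rewrite det_gale_mx1; apply: eq_bigr => j _.
  rewrite /gale det_gale_mx1 (bigD1 j) //= big1 ?addr0; last first.
    by move=> k kj; rewrite mxE (negPf kj) mul0r.
  by rewrite !mxE !eqxx mul1r mulrC.
rewrite -det_tr.
apply: (determinant_alternate (i1 := lift ord0 ord0) (i2 := lift ord0 (lift ord0 c))) => // r.
by rewrite [LHS]mxE [RHS]mxE gale_mx1 gale_mxSS mxE.
Qed.

(* [z = G i j G k . - G i k G j . + G j k G i .] is killed by the invertible
   matrix whose determinant is [G i j]. *)
Lemma gale_GP (i j k l : 'I_n.+2) : gale V i j != 0 ->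
  gale V i j * gale V k l = gale V i k * gale V j l - gale V i l * gale V j k.
Proof.
move=> Gij; pose A := gale_mx V (delta_mx i 0) (delta_mx j 0).
have Gii m : gale V m m = 0.
  rewrite /gale -det_tr.
  apply: (determinant_alternate (i1 := ord0) (i2 := lift ord0 ord0)) => // r.
  by rewrite [LHS]mxE [RHS]mxE gale_mx0 gale_mx1.
pose z : 'rV[R]_n.+2 := \row_m (gale V i j * gale V k m
  - gale V i k * gale V j m + gale V j k * gale V i m).
have sum_delta m : \sum_r z 0 r * (delta_mx m 0 : 'cV[R]_n.+2) r 0 = z 0 m.
  rewrite (bigD1 m) //= big1 ?addr0; first by rewrite [X in _ * X]mxE !eqxx mulr1.
  by move=> r rm; rewrite [X in _ * X]mxE (negPf rm) mulr0.
have zA : z *m A = 0.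
  apply/rowP => c; rewrite mxE [RHS]mxE.
  (* The two unit columns read off entries [i] and [j] of [z], which vanish by antisymmetry; the
     columns of [V] are handled by [gale_mulmx]. *)
  case: (unliftP ord0 c) => [c1 -> | ->]; last first.
    under eq_bigr => r _ do rewrite gale_mx0.
    by rewrite sum_delta mxE Gii (gale_anti i k) (gale_anti i j); ring.
  case: (unliftP ord0 c1) => [c2 -> | ->]; last first.
    under eq_bigr => r _ do rewrite gale_mx1.
    by rewrite sum_delta mxE Gii (gale_anti j k); ring.
  under eq_bigr => r _ do rewrite gale_mxSS mxE !mulrDl mulNr -!mulrA.
  rewrite !big_split /= sumrN -!big_distrr /= !gale_mulmx.
  by rewrite !mulr0 subrr addr0.
have z0 : z = 0.
  by rewrite -(mulmxK (_ : A \in unitmx) z) ?zA ?mul0mx // unitmxE unitfE.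
move/rowP: z0 => /(_ l); rewrite !mxE => /eqP; rewrite -subr_eq0 => /eqP z0.
by apply/eqP; rewrite -subr_eq0 -z0; apply/eqP; ring.
Qed.
End Gale.

Lemma sum_sgz_minors (R : realFieldType) (n : nat) (V : 'M[R]_(n.+2, n)) :
  ~~ odd n ->
  (forall i k, \det (row' k (row' i V)) != 0) ->
  \sum_(i < n.+2) (-1) ^+ i * \prod_(k < n.+1) sgz (\det (row' k (row' i V))) = 0.
Proof.
move=> n_even V_neq0.
have gale_neq0 i j : i != j -> gale V i j != 0.
  move=> /unlift_some[k -> _].
  by rewrite gale_lift mulf_neq0 // expf_neq0 // oppr_eq0 oner_eq0.
have minorE i k : \det (row' k (row' i V)) = (-1) ^+ (i + k) * gale V i (lift i k).
  by rewrite gale_lift mulrA -exprD addnn -signr_odd odd_double mul1r.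
have sgz_sign m : sgz ((-1) ^+ m : R) = (-1) ^+ m by rewrite sgzX sgzN1.
pose C : int := \prod_(k < n.+1) (-1) ^+ k.
have termE (i : 'I_n.+2) : (-1) ^+ i * \prod_(k < n.+1) sgz (\det (row' k (row' i V))) =
    C * \prod_(k < n.+1) sgz (gale V i (lift i k)).
  under eq_bigr => k _ do rewrite minorE sgzM sgz_sign exprD.
  (* The sign depending on [i] is -1 to the power [i + i * (n + 1)], which is even; the signs in [k]
     make up the constant [C]. *)
  rewrite !big_split /= prodr_const card_ord -/C !mulrA -exprM -exprD.
  by rewrite mulnS addnA -signr_odd oddD oddM addnn odd_double (negPf n_even) andbF mul1r.
rewrite (eq_bigr _ (fun i _ => termE i)) -big_distrr /= sum_prod_sgz_rank2 ?mulr0 //.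
- by move=> i j; exact: gale_anti.
- by move=> k l; apply: gale_GP; apply: gale_neq0.
Qed.

(** * Determinants of lists of rows, and extension by a flag *)

Definition rows_det {R : comPzRingType} {n : nat} (s : seq 'rV[R]_n) : R :=
  \det (\matrix_(i < n) nth 0 s i).

(** The determinant reads the first [n] entries, padded with 0; [size s < n] makes [x] one of its
    rows, and [c] collects the cofactors of that row. *)
Lemma rows_det_lin (R : comPzRingType) (n : nat) (s u : seq 'rV[R]_n) :
  (size s < n)%N ->
  exists c : 'cV[R]_n, forall x : 'rV_n, rows_det (s ++ x :: u) = (x *m c) 0 0.
Proof.
move=> s_lt; pose i0 := Ordinal s_lt.
pose A x := \matrix_(i < n) nth 0 (s ++ x :: u) i.
exists (\col_j cofactor (A 0) i0 j) => x.
rewrite /rows_det -/(A x) (expand_det_row _ i0) mxE; apply: eq_bigr => j _.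
rewrite [X in X * _]mxE nth_cat ltnn subnn /=; congr (_ * _).
rewrite mxE; congr (_ * \det _); apply/matrixP => r c; rewrite !mxE !nth_cat.
case: ltnP => // le_sr; case def_k: (_ - _)%N => [|k] //.
have /eqP := neq_lift i0 r; case; apply: val_inj => /=.
by apply/eqP; rewrite eqn_leq le_sr /= -subn_eq0 def_k.
Qed.

Lemma rows_det_dep (R : fieldType) (n : nat) (s u : seq 'rV[R]_n) (x : 'rV_n) :
  (size s < n)%N -> (x <= stack s)%MS -> rows_det (s ++ x :: u) = 0.
Proof.
move=> s_lt /submxP[y ->]; have [c cE] := rows_det_lin _ _ s u s_lt.
rewrite cE -mulmxA.
suff -> : stack s *m c = 0 by rewrite mulmx0 mxE.
apply/row_matrixP => i; rewrite row_mul row0; apply/rowP => j.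
rewrite ord1 -cE mxE rowK.
have i_lt : (i < n)%N by apply: ltn_trans s_lt.
apply: (determinant_alternate (i1 := Ordinal i_lt) (i2 := Ordinal s_lt)).
  by rewrite -val_eqE /= neq_ltn ltn_ord.
by move=> k; rewrite !mxE !nth_cat /= ltn_ord ltnn subnn.
Qed.

Lemma row_free_ext (R : fieldType) (n : nat) (s : seq 'rV[R]_n) (F : 'M_n) :
  row_free (stack s) -> row_free (stack (ext s F)).
Proof.
move=> s_free; rewrite /ext; case: pickP => [i /andP[Fi _] | _] //.
set x := row i F in Fi *.
have sub_rcons : (stack s + x <= stack (rcons s x))%MS.
  rewrite addsmx_sub; apply/andP; split.
    apply/row_subP => k.
    have k_lt : (k < size (rcons s x))%N by rewrite size_rcons ltnS ltnW.
    apply: (eq_row_sub (Ordinal k_lt)).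
    by apply/rowP => j; rewrite !mxE nth_rcons /= ltn_ord.
  have k_lt : (size s < size (rcons s x))%N by rewrite size_rcons.
  apply: (eq_row_sub (Ordinal k_lt)).
  by apply/rowP => j; rewrite !mxE nth_rcons /= ltnn eqxx mxE.
rewrite -row_leq_rank {1}size_rcons -{1}(eqP s_free).
apply: leq_trans (mxrankS sub_rcons); apply: rank_ltmx.
by rewrite ltmxE addsmxSl addsmx_sub submx_refl (negPf Fi).
Qed.

Lemma ext_rcons (R : fieldType) (n : nat) (s : seq 'rV[R]_n) (F : 'M_n) :
  is_flag F -> (size s < n)%N ->
  exists2 i : 'I_n, ext s F = rcons s (row i F) &
    forall j : 'I_n, (j < i)%N -> (row j F <= stack s)%MS.
Proof.
move=> F_flag s_lt; rewrite /ext; case: pickP => [i /andP[_ /forallP le_i] | no_i].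
  by exists i => // j; apply/implyP.
(* If no row is picked, strong induction on the index puts every row of [F] in the span of [s],
   whose dimension is less than [n]. *)
suff /mxrankS : (F <= stack s)%MS.
  rewrite mxrank_unit // leqNgt => /negP[].
  exact: leq_ltn_trans (rank_leq_row _) s_lt.
apply/row_subP => i; have [m] := ubnP i; elim: m => // m IHm in i * => lt_im.
move/(_ i)/negbT: no_i; rewrite negb_and negbK => /orP[//|/negP[]].
apply/forallP => j; apply/implyP => ji; apply: IHm.
exact: leq_trans ji _.
Qed.

(** * Perturbing flags into vectors *)

Lemma sign_lowest_term (R : realFieldType) (n : nat) (a : 'I_n -> R) (d : 'I_n) :
  (forall j : 'I_n, (j < d)%N -> a j = 0) -> a d != 0 ->
  exists2 e, 0 < e & forall t : R, 0 < t < e -> 0 < (\sum_(j < n) t ^+ j * a j) * a d.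
Proof.
move=> a_lt ad; pose M := \sum_j `|a j|.
have M_ge0 : 0 <= M by apply: sumr_ge0.
(* The sum is [t ^+ d * (a d + t * r)]. The bound [t < 1] gives [|r| <= M], and the other bound then
   gives [|t * r| < |a d|]; [M + 1] avoids division by 0. *)
exists (Num.min 1 (`|a d| / (M + 1))) => [|t].
  by rewrite lt_min ltr01 divr_gt0 ?normr_gt0 // ltr_wpDl.
rewrite lt_min => /and3P[t_gt0 t_lt1]; rewrite ltr_pdivlMr ?ltr_wpDl // => t_lt.
pose r := \sum_(j < n | (d < (j : nat))%N) t ^+ (j - d.+1) * a j.
have -> : \sum_(j < n) t ^+ j * a j = t ^+ d * (a d + t * r).
  rewrite (bigID (fun j : 'I_n => (d < j)%N)) /= addrC mulrDr; congr (_ + _).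
    rewrite (bigD1 d) ?ltnn //= big1 ?addr0 // => j /andP[].
    rewrite -leqNgt => le_jd neq_jd; rewrite a_lt ?mulr0 //.
    by rewrite ltn_neqAle neq_jd.
  rewrite /r !big_distrr /=; apply: eq_bigr => j lt_dj.
  by rewrite -{1}(subnKC lt_dj) exprD exprS; ring.
have r_le : `|r| <= M.
  apply: le_trans (ler_norm_sum _ _ _) _.
  rewrite /M [leRHS](bigID (fun j : 'I_n => (d < j)%N)) /= -[leLHS]addr0.
  apply: lerD; last exact: sumr_ge0.
  apply: ler_sum => j _; rewrite normrM ler_piMl // ger0_norm ?exprn_ge0 ?exprn_ile1 ?ltW //.
rewrite -mulrA mulr_gt0 ?exprn_gt0 // mulrDl.
have tr_lt : `|t * r| < `|a d|.
  rewrite normrM (gtr0_norm t_gt0); apply: le_lt_trans t_lt.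
  by rewrite ler_pM2l //; apply: le_trans r_le _; rewrite lerDl.
have : `|t * r * a d| < a d * a d.
  by rewrite normrM -expr2 -[ltRHS]ger0_norm ?sqr_ge0 // normrX expr2 ltr_pM2r ?normr_gt0.
by rewrite ltr_norml => /andP[lo _]; move: lo; rewrite -subr_gt0 opprK addrC.
Qed.

Lemma rows_det_neq0 (R : fieldType) (n : nat) (s : seq 'rV[R]_n) :
  size s = n -> row_free (stack s) -> rows_det s != 0.
Proof.
move=> size_s s_free; rewrite /rows_det -unitfE -unitmxE -row_free_unit -row_leq_rank.
apply: leq_trans (eq_leq (esym size_s)) _; rewrite -(eqP s_free); apply: mxrankS; apply/row_subP => i.
have i_lt : (i < n)%N := leq_trans (ltn_ord i) (eq_leq size_s).
by apply: (eq_row_sub (Ordinal i_lt)); apply/rowP => j; rewrite !mxE.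
Qed.

Lemma near0_all (R : realFieldType) (T : eqType) (P : seq T) (Q : T -> R -> Prop) :
  (forall p, p \in P -> exists2 e, 0 < e & forall t, 0 < t < e -> Q p t) ->
  exists2 e, 0 < e & forall t p, 0 < t < e -> p \in P -> Q p t.
Proof.
elim: P => [|p P IHP] QP; first by exists 1 => //; exact: ltr01.
have [e e_gt0 eQ] := QP p (mem_head _ _).
have [|f f_gt0 fQ] := IHP; first by move=> q qP; apply: QP; rewrite inE qP orbT.
exists (Num.min e f) => [|t q]; first by rewrite lt_min e_gt0.
rewrite lt_min => /and3P[t_gt0 t_lte t_ltf]; rewrite inE => /orP[/eqP -> | qP].
  by apply: eQ; rewrite t_gt0.
by apply: fQ; rewrite ?t_gt0.
Qed.

(* [x = \sum_j t ^+ j *: row j F] for small [t > 0]: modulo [s], its leading term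
   is the row that [ext] selects. *)
Lemma perturb_flag (R : realFieldType) (n : nat) (F : 'M[R]_n)
    (P : seq (seq 'rV[R]_n * seq 'rV[R]_n)) :
  is_flag F ->
  exists x, forall s u, (s, u) \in P -> (size s < n)%N ->
    rows_det (ext s F ++ u) != 0 ->
    0 < rows_det (s ++ x :: u) * rows_det (ext s F ++ u).
Proof.
move=> F_flag; pose x (t : R) := \sum_(j < n) t ^+ j *: row j F.
pose Q (p : seq 'rV[R]_n * seq 'rV[R]_n) t := (size p.1 < n)%N ->
  rows_det (ext p.1 F ++ p.2) != 0 ->
  0 < rows_det (p.1 ++ x t :: p.2) * rows_det (ext p.1 F ++ p.2).
have [p _|e e_gt0 eQ] := @near0_all R _ P Q; last first.
  exists (x (e / 2)) => s u su; apply: (eQ (e / 2) (s, u)) => //.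
  by rewrite divr_gt0 //= ltr_pdivrMr // mulr_natr mulr2n ltrDl.
case: p => s u; rewrite /Q /=.
case: (ltnP (size s) n) => [s_lt|_]; last by exists 1; rewrite ?ltr01.
have [i -> lt_i] := ext_rcons _ _ s F F_flag s_lt.
have [c cE] := rows_det_lin _ _ s u s_lt.
rewrite cat_rcons; pose a j := rows_det (s ++ row j F :: u).
have [ai|ai] := eqVneq (a i) 0; first by exists 1; rewrite ?ltr01 // -/(a i) ai eqxx.
(* Rows before the selected one lie in the span of [s], so the coefficients below degree [i]
   vanish. *)
have [j ji|e e_gt0 eP] := sign_lowest_term _ _ a i _ ai.
  by apply: rows_det_dep => //; exact: lt_i.
exists e => // t /eP at_gt0 _ _; rewrite -/(a i).
suff -> : rows_det (s ++ x t :: u) = \sum_(j < n) t ^+ j * a j by [].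
rewrite cE /x mulmx_suml summxE; apply: eq_bigr => j _.
by rewrite -scalemxAl mxE /a cE.
Qed.

(** A positive product encodes equality of nonzero signs, and this is its transitivity. *)
Lemma mulr_gt0_trans (R : realDomainType) (a b c : R) :
  0 < a * b -> 0 < b * c -> 0 < a * c.
Proof.
move=> ab bc; have b_neq0 : b != 0 by apply: contraTneq ab => ->; rewrite mulr0 ltxx.
have b2 : 0 < b ^+ 2 by rewrite exprn_even_gt0.
have : 0 < b ^+ 2 * (a * c) by have := mulr_gt0 ab bc; congr (0 < _); ring.
by rewrite pmulr_rgt0.
Qed.

(* Flags are perturbed from the last one to the first, so that the parameter of
   each flag is small with respect to those of the flags after it. *)
Lemma perturb_flags (R : realFieldType) (n : nat) (Fs : seq 'M[R]_n)
    (L : seq (seq 'rV[R]_n)) :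
  all (@is_flag R n) Fs ->
  (forall s, s \in L -> row_free (stack s)) ->
  exists2 vs : seq 'rV[R]_n, size vs = size Fs &
    forall s m, s \in L -> size m = size Fs -> (size s + count id m)%N = n ->
    0 < rows_det (s ++ mask m vs) * rows_det (foldl (@ext R n) s (mask m Fs)).
Proof.
elim: Fs L => [|F Fs IHFs] L /=.
  move=> _ L_free; exists [::] => // s m sL /size0nil -> /=; rewrite addn0 cats0 => size_s.
  by rewrite -expr2 exprn_even_gt0 //= rows_det_neq0 // L_free.
move=> /andP[F_flag Fs_flag] L_free.
(* A mask either skips [F], leaving the prefix [s], or keeps it, giving [ext s F]; the later vectors
   must serve both. *)
have [s|vs size_vs vsP] := IHFs (L ++ [seq ext s F | s <- L]) Fs_flag.
  rewrite mem_cat => /orP[/L_free//|/mapP[s' /L_free s'_free ->]].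
  exact: row_free_ext.
(* The later vectors are now fixed, so finitely many conditions bear on the new one. *)
pose P := [seq (s, mask (tval m) vs) | s <- L, m <- enum {: (size Fs).-tuple bool}].
have [x xP] := perturb_flag _ _ F P F_flag.
exists (x :: vs) => [/=|s [|[] m] sL //= [size_m]]; first by rewrite size_vs.
  rewrite addnA addn1 => size_s.
  have s_lt : (size s < n)%N := leq_trans (leq_addr _ _) (eq_leq size_s).
  have size_ext : size (ext s F) = (size s).+1.
    by have [i -> _] := ext_rcons _ _ s F F_flag s_lt; rewrite size_rcons.
  have ext_gt0 : 0 < rows_det (ext s F ++ mask m vs) *
      rows_det (foldl (@ext R n) (ext s F) (mask m Fs)).
    by apply: vsP; rewrite ?size_ext // mem_cat (map_f (fun s => ext s F)) ?orbT.
  apply: mulr_gt0_trans (ext_gt0); apply: xP => //.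
    apply/allpairsP; exists (s, tcast size_m (in_tuple m)).
    by rewrite mem_enum /= val_tcast.
  by apply: contraTneq ext_gt0 => ->; rewrite mul0r ltxx.
by move=> size_s; apply: vsP => //; rewrite mem_cat sL.
Qed.

(** * Omissions as masks, and the conclusion *)

Lemma nth_omit (T : Type) (x0 : T) (i : nat) (s : seq T) (k : nat) :
  (i < size s)%N -> nth x0 (omit i s) k = nth x0 s (bump i k).
Proof.
move=> i_lt; rewrite /omit nth_cat size_take i_lt /bump.
case: ltnP => [k_lt | le_ik]; first by rewrite nth_take.
by rewrite nth_drop addSn subnKC // add1n.
Qed.

Lemma size_omit (T : Type) (i : nat) (s : seq T) :
  (i < size s)%N -> size (omit i s) = (size s).-1.
Proof.
move=> i_lt; rewrite /omit size_cat size_take i_lt size_drop.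
by rewrite -[in RHS](subnKC i_lt).
Qed.

Lemma subseq_omit (T : eqType) (i : nat) (s : seq T) : subseq (omit i s) s.
Proof.
rewrite -[X in subseq _ X](cat_take_drop i s) cat_subseq //.
by rewrite -[X in drop X]add1n -drop_drop drop_subseq.
Qed.

Lemma omit_map (S T : Type) (f : S -> T) (i : nat) (s : seq S) :
  omit i (map f s) = map f (omit i s).
Proof. by rewrite /omit map_cat map_take map_drop. Qed.

(** Omission commutes with [map], so a mask found on the list of indices serves every list, in
    particular both flags and vectors. *)
Lemma omit2_mask (N i k : nat) : (i < N.+2)%N -> (k < N.+1)%N ->
  exists m, [/\ size m = N.+2, count id m = N
    & forall (T : Type) (s : seq T), size s = N.+2 -> omit k (omit i s) = mask m s].
Proof.
move=> i_lt k_lt; pose w := iota 0 N.+2.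
have /subseqP[m size_m def_m] : subseq (omit k (omit i w)) w.
  exact: subseq_trans (subseq_omit _ _ _) (subseq_omit _ _ _).
rewrite size_iota in size_m; exists m; split=> // [|T [//|x0 s] size_s].
  by rewrite -(size_mask (s := w)) ?size_iota // -def_m !size_omit ?size_iota.
by rewrite -(mkseq_nth x0 (x0 :: s)) size_s /mkseq !omit_map def_m map_mask.
Qed.

Theorem theorem4p2 (R : realFieldType) (n : nat) (hn : ~~ odd n)
  (Fs : (n.+2).-tuple 'M[R]_n) (hF : all (@is_flag R n) Fs) :
  dE (tval Fs) = 0.
Proof.
have [s|vs] := @perturb_flags R n Fs [:: [::]] hF.
  by rewrite inE => /eqP ->; rewrite -row_leq_rank.
rewrite size_tuple => size_vs vsP.
pose V : 'M[R]_(n.+2, n) := \matrix_i nth 0 vs i.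
have minorE (i : 'I_n.+2) (k : 'I_n.+1) :
    \det (row' k (row' i V)) = rows_det (omit k (omit i vs)).
  congr (\det _); apply/matrixP => r c.
  by rewrite !mxE !nth_omit ?size_omit ?size_vs.
have minor_gt0 (i : 'I_n.+2) (k : 'I_n.+1) :
    0 < \det (row' k (row' i V)) * rows_det (bracket (omit k (omit i (tval Fs)))).
  have [m [size_m count_m mE]] := omit2_mask _ _ _ (ltn_ord i) (ltn_ord k).
  rewrite minorE !mE ?size_tuple //; by apply: (vsP [::] m); rewrite ?mem_head ?size_tuple.
have V_neq0 (i : 'I_n.+2) (k : 'I_n.+1) : \det (row' k (row' i V)) != 0.
  by apply: contraTneq (minor_gt0 i k) => ->; rewrite mul0r ltxx.
rewrite -[RHS](sum_sgz_minors _ _ V hn V_neq0) /dE size_tuple.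
apply: eq_bigr => i _; rewrite /E size_omit ?size_tuple //=; congr (_ * _).
(* Both determinants have the same nonzero sign, so the value -1 of [Or] at determinant 0 never
   occurs. *)
apply: eq_bigr => k _; move: (minor_gt0 i k); rewrite /Or -/(rows_det _).
case: (ltgtP (\det (row' k (row' i V))) 0) (V_neq0 i k) => // [lt0|gt0] _.
  by rewrite nmulr_rgt0 // => /ltW; rewrite leNgt => /negPf ->; rewrite ltr0_sgz.
by rewrite pmulr_rgt0 // => ->; rewrite gtr0_sgz.
Qed.
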